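(* Let $\mathrm{T}$ be a complete theory of unital $\mathrm{C}^*$-algebras such that every model $A$ of $\mathrm{T}$ satisfies the following conditions: (a) for all $p, q \in \mathcal{P}(A)$, $pq = qp$; (b) $A$ has no minimal projections, i.e. for every $p \in \mathcal{P}(A) \setminus \{0\}$ there exists $q \in \mathcal{P}(A)$ with $0 \lneq q \lneq p$. Then there exist a definable set $X$ relative to $\mathrm{T}$ and a (possibly definable) formula $\varphi(\bar x,\bar y)$ such that: (1) for every $M \models \mathrm{T}$ and all $\bar a, \bar b \in X(M)$, $\varphi^M(\bar a, \bar b) \in \{0,1\}$; (2) for every $M \models \mathrm{T}$ and all $\bar a, \bar b \in X(M)$, if $\varphi^M(\bar a, \bar b) = 0$, then $\varphi^M(\bar b, \bar a) = 1$; (3) for every $M \models \mathrm{T}$, every $n < \omega$ and all $\bar a_i \in X(M)$ $(i < n)$, there exists $\bar b \in X(M)$ such that $\varphi^M(\bar a_i, \bar b) = 0$ for all $i < n$.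
   Context: For a $\mathrm{C}^*$-algebra $A$, $\mathcal{P}(A)$ denotes the set of projections of $A$ (elements $p$ with $p = p^* = p^2$), with the usual order. Unital $\mathrm{C}^*$-algebras are assumed to satisfy $1 \ne 0$. Unital $\mathrm{C}^*$-algebras are regarded as metric structures in continuous logic in the usual way: quantifiers range over norm-closed balls; terms are complex $*$-polynomials (with the constant $1$); atomic formulas are norms $\|t(\bar x)\|$ of terms; formulas are built from atomic formulas by continuous functions $\mathbb{R}^n\to\mathbb{R}$ and the quantifiers $\sup$ and $\inf$ over balls. The value $0$ plays the role of ''true'': a theory $\mathrm{T}$ is a set of sentences, and $M \models \mathrm{T}$ means $\sigma^M = 0$ for all $\sigma\in \mathrm{T}$. A theory of unital $\mathrm{C}^*$-algebras is one all of whose models are unital $\mathrm{C}^*$-algebras. $\mathrm{T}$ is complete if it has a model and any two models assign the same value to every sentence. A definable formula (definable predicate) relative to $\mathrm{T}$ is a uniform limit, over all models of $\mathrm{T}$ (with variables restricted to fixed balls), of formulas in a fixed tuple of variables (without parameters). A definable set $X$ relative to $\mathrm{T}$ is an assignment to each $M \models \mathrm{T}$ of a closed subset $X(M)$ of a fixed finite product of balls of $M$ such that the distance function $\bar x \mapsto d(\bar x, X(M))$ is given, in all models $M$ of $\mathrm{T}$, by one and the same definable formula. In $\varphi(\bar x,\bar y)$, both $\bar x$ and $\bar y$ range over the finite product of balls in which $X$ lives. *)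

(* Defs.v *)
From HB Require Import structures.
From mathcomp Require Import all_boot all_order all_algebra.
From mathcomp Require Import complex.
From mathcomp Require Import all_classical all_reals all_analysis.

Set Implicit Arguments.
Unset Strict Implicit.
Unset Printing Implicit Defensive.

Import Order.TTheory GRing.Theory Num.Theory numFieldNormedType.Exports.

Local Open Scope classical_set_scope.
Local Open Scope ring_scope.
Local Open Scope complex_scope.

(* Complex unital C*-algebras.  Norms take their values in the nonnegative reals
   of R[i], as for every normed module over a [numFieldType].  The hierarchies of
   algebras and of normed modules have no join, hence a record on top of
   [completeNormedModType] whose carrier [csort] is then equipped with both
   structures. *)
Record cstarAlgType (R : realType) := CStarAlg {
  cstar_normed : completeNormedModType R[i] ;
  cstar_one : cstar_normed ;
  cstar_mul : cstar_normed -> cstar_normed -> cstar_normed ;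
  cstar_star : cstar_normed -> cstar_normed ;
  cstar_mulA : associative cstar_mul ;
  cstar_mul1l : left_id cstar_one cstar_mul ;
  cstar_mul1r : right_id cstar_one cstar_mul ;
  cstar_mulDl : left_distributive cstar_mul +%R ;
  cstar_mulDr : right_distributive cstar_mul +%R ;
  cstar_one_neq0 : cstar_one != 0 ;
  cstar_scaleAl : forall (c : R[i]) x y,
    c *: cstar_mul x y = cstar_mul (c *: x) y ;
  cstar_scaleAr : forall (c : R[i]) x y,
    c *: cstar_mul x y = cstar_mul x (c *: y) ;
  cstar_starK : involutive cstar_star ;
  cstar_starD : {morph cstar_star : x y / x + y} ;
  cstar_starZ : forall (c : R[i]) x,
    cstar_star (c *: x) = c^* *: cstar_star x ;
  cstar_starM : forall x y,
    cstar_star (cstar_mul x y) = cstar_mul (cstar_star y) (cstar_star x) ;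
  cstar_normM : forall x y, `|cstar_mul x y| <= `|x| * `|y| ;
  cstar_norm_starM : forall x, `|cstar_mul (cstar_star x) x| = `|x| ^+ 2 }.

Definition csort (R : realType) (A : cstarAlgType R) : Type := cstar_normed A.
Coercion csort : cstarAlgType >-> Sortclass.

Section Instances.
Context (R : realType) (A : cstarAlgType R).

HB.instance Definition _ :=
  CompleteNormedModule.copy (csort A) (cstar_normed A).
HB.instance Definition _ := GRing.Zmodule_isNzRing.Build (csort A)
  (@cstar_mulA R A) (@cstar_mul1l R A) (@cstar_mul1r R A)
  (@cstar_mulDl R A) (@cstar_mulDr R A) (@cstar_one_neq0 R A).
HB.instance Definition _ :=
  GRing.Lmodule_isLalgebra.Build R[i] (csort A) (@cstar_scaleAl R A).
HB.instance Definition _ :=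
  GRing.Lalgebra_isAlgebra.Build R[i] (csort A) (@cstar_scaleAr R A).

End Instances.

Section CStar.
Context {R : realType} {A : cstarAlgType R}.
Implicit Types (x p q : A) (r : R).

Definition star x : A := cstar_star x.

Definition cnorm x : R := complex.Re `|x|.

Lemma normr_cnorm x : `|x| = (cnorm x)%:C.
Proof. by rewrite /cnorm RRe_real// normr_real. Qed.

Definition cball r : set A := [set x | cnorm x <= r].

Definition projection p := p = star p /\ p = p ^+ 2.

(* The order of projections; it is used only between projections. *)
Definition proj_le p q := p * q = p.

Definition proj_lt p q := proj_le p q /\ p <> q.

End CStar.

Section Syntax.
Context (R : realType).

(* [term n] and [formula n] have their free variables among 0, ..., n - 1. *)
Inductive term (n : nat) :=
| TVar of 'I_n
| TOne
| TAdd of term n & term n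
| TMul of term n & term n
| TScale of R[i] & term n
| TStar of term n.

(* In [FSup r f] and [FInf r f] the bound variable is variable 0 of [f] and
   ranges over the closed ball of radius [r]. *)
Inductive formula : nat -> Type :=
| FNorm n of term n : formula n
| FConn n k (u : 'rV[R]_k -> R) of continuous u & ('I_k -> formula n) :
    formula n
| FSup n of {posnum R} & formula n.+1 : formula n
| FInf n of {posnum R} & formula n.+1 : formula n.

Definition sentence := formula 0.

(* Structures are unital C*-algebras: the axioms of unital C*-algebras are
   implicitly part of every theory. *)
Definition theory := set sentence.

End Syntax.

Section Semantics.
Context {R : realType} (M : cstarAlgType R).

Fixpoint teval n (x : 'rV[M]_n) (t : term R n) : M :=
  match t with
  | TVar i => x 0 i
  | TOne => 1
  | TAdd s t => teval x s + teval x t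
  | TMul s t => teval x s * teval x t
  | TScale c s => c *: teval x s
  | TStar s => star (teval x s)
  end.

Definition vcons n (a : M) (x : 'rV[M]_n) : 'rV[M]_n.+1 :=
  row_mx (const_mx a : 'rV[M]_1) x.

(* Formulas are bounded on products of balls, so that [sup] and [inf] below are
   taken over nonempty bounded sets of real numbers. *)
Fixpoint feval n (f : formula R n) : 'rV[M]_n -> R :=
  match f in formula _ n return 'rV[M]_n -> R with
  | FNorm _ t => fun x => cnorm (teval x t)
  | FConn _ k u _ g => fun x => u (\row_(i < k) feval (g i) x)
  | FSup _ r g => fun x => sup [set feval g (vcons a x) | a in cball r%:num]
  | FInf _ r g => fun x => inf [set feval g (vcons a x) | a in cball r%:num]
  end.

Definition sval_in (s : sentence R) : R := feval s 0.

Definition satisfies (T : theory R) := forall s, T s -> sval_in s = 0.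

Definition box n (rho : 'rV[R]_n) : set 'rV[M]_n :=
  [set x | forall i, cball (rho 0 i) (x 0 i)].

Definition tdist n (x y : 'rV[M]_n) : R :=
  \big[Num.max/0]_(i < n) cnorm (x 0 i - y 0 i).

Definition set_dist n (x : 'rV[M]_n) (Y : set 'rV[M]_n) : R :=
  inf [set tdist x y | y in Y].

End Semantics.

Arguments sval_in {R} M s.
Arguments satisfies {R} M T.
Arguments box {R} M {n} rho.

Section Definability.
Context {R : realType} (T : theory R).

Definition complete_theory :=
  (exists M : cstarAlgType R, satisfies M T) /\
  forall M N : cstarAlgType R, satisfies M T -> satisfies N T ->
    forall s : sentence R, sval_in M s = sval_in N s.

(* Only the values of [P] at models of [T] and at points of the box matter; the
   same holds of [X] in [definable_set]. *)
Definition definable_formula n (rho : 'rV[R]_n)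
    (P : forall M : cstarAlgType R, 'rV[M]_n -> R) :=
  exists f : nat -> formula R n, forall e : R, 0 < e ->
    exists N, forall k, (N <= k)%N ->
      forall M : cstarAlgType R, satisfies M T -> forall x, box M rho x ->
        `|feval (f k) x - P M x| <= e.

(* [X M] is required to be nonempty because the distance to the empty set is
   not a real number ([inf set0] is 0 by convention). *)
Definition definable_set n (rho : 'rV[R]_n)
    (X : forall M : cstarAlgType R, set 'rV[M]_n) :=
  [/\ forall i, 0 < rho 0 i,
      forall M : cstarAlgType R, satisfies M T ->
        [/\ X M `<=` box M rho, closed (X M) & X M !=set0] &
      definable_formula rho (fun M x => set_dist x (X M))].

End Definability.

(* Main.v *)
(* The projections of a model form an atomless Boolean algebra in which nonzero
   elements have norm 1.  Call [y] unsplit by [x] if [y] is nonzero and [y <= x] or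
   [y <= 1 - x].  Finitely many [x] always leave some common [y] unsplit, and
   finitely many nonzero [y] are always split by a common [x].  Hence, on pairs of
   projections, "[y'] is unsplit by [x] and [y] is split by [x']" is an asymmetric
   relation between [(x, y)] and [(x', y')] under which finite sets have upper
   bounds.

   The set of projections is definable because, by Newton's method, a selfadjoint
   contraction [z] is within [10 * `|z ^+ 2 - z|] of a projection: the distance
   from [x] to the projections is then exactly the infimum of
   [`|x - z| + 10 * `|z ^+ 2 - z|] over [z = star y * y], [y] in the unit ball. *)
Require Import Defs.
From mathcomp Require Import all_boot all_order all_algebra.
From mathcomp Require Import complex.
From mathcomp Require Import all_classical all_reals all_analysis.
From mathcomp Require Import ring lra.
Import Order.TTheory GRing.Theory Num.Theory numFieldNormedType.Exports.
Local Open Scope classical_set_scope.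
Local Open Scope ring_scope.

(** * Norm, involution and projections in a C*-algebra *)

Section Norm.
Context {R : realType} {A : cstarAlgType R}.
Implicit Types x y p q : A.

Lemma cnorm_ge0 x : 0 <= cnorm x.
Proof. by rewrite -lecR -normr_cnorm; exact: normr_ge0. Qed.

Lemma cnorm0_eq0 x : cnorm x = 0 -> x = 0.
Proof. by move=> x0; apply: normr0_eq0; rewrite normr_cnorm x0. Qed.

Lemma cnorm0 : cnorm (0 : A) = 0.
Proof. by rewrite /cnorm normr0. Qed.

Lemma cnormN x : cnorm (- x) = cnorm x.
Proof. by rewrite /cnorm normrN. Qed.

Lemma cnormD x y : cnorm (x + y) <= cnorm x + cnorm y.
Proof. by rewrite -lecR rmorphD /= -!normr_cnorm ler_normD. Qed.

Lemma cnormB x y : cnorm (x - y) <= cnorm x + cnorm y.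
Proof. by rewrite -(cnormN y) cnormD. Qed.

Lemma cnorm_distD y x z : cnorm (x - z) <= cnorm (x - y) + cnorm (y - z).
Proof. by rewrite -lecR rmorphD /= -!normr_cnorm ler_distD. Qed.

Lemma cnorm_distC x y : cnorm (x - y) = cnorm (y - x).
Proof. by rewrite -cnormN opprB. Qed.

Lemma cnormM x y : cnorm (x * y) <= cnorm x * cnorm y.
Proof. by rewrite -lecR rmorphM /= -!normr_cnorm cstar_normM. Qed.

Lemma cnormMn x n : cnorm (x *+ n) = cnorm x *+ n.
Proof.
by apply: complexI; rewrite rmorphMn /= -!normr_cnorm normrMn.
Qed.

Lemma starK x : star (star x) = x. Proof. exact: cstar_starK. Qed.
Lemma starD x y : star (x + y) = star x + star y.
Proof. exact: cstar_starD. Qed.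
Lemma starM x y : star (x * y) = star y * star x.
Proof. exact: cstar_starM. Qed.

Lemma star0 : star (0 : A) = 0.
Proof. by apply: (addrI (star 0)); rewrite -starD !addr0. Qed.

Lemma starN x : star (- x) = - star x.
Proof. by apply: (addrI (star x)); rewrite -starD !subrr star0. Qed.

Lemma starB x y : star (x - y) = star x - star y.
Proof. by rewrite starD starN. Qed.

Lemma star1 : star (1 : A) = 1.
Proof. by rewrite -[RHS]starK -[X in _ = star X]mulr1 starM starK mulr1. Qed.

Lemma cnorm_starM x : cnorm (star x * x) = cnorm x ^+ 2.
Proof.
by apply: complexI; rewrite rmorphXn /= -!normr_cnorm cstar_norm_starM.
Qed.

(** The C*-identity gives [|x|^2 = |star x * x| <= |star x| |x|]; cancel [|x|]. *)
Lemma cnorm_star_le x : cnorm x <= cnorm (star x).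
Proof.
have [x0|x0] := eqVneq (cnorm x) 0; first by rewrite x0 cnorm_ge0.
have x_gt0 : 0 < cnorm x by rewrite lt_def x0 cnorm_ge0.
by rewrite -(ler_pM2r x_gt0) -expr2 -cnorm_starM cnormM.
Qed.

Lemma cnorm_star x : cnorm (star x) = cnorm x.
Proof.
by apply/le_anti; rewrite cnorm_star_le -{2}(starK x) cnorm_star_le.
Qed.

Lemma projection_mulrr p : projection p -> p * p = p.
Proof. by move=> pP; rewrite [RHS]pP.2 expr2. Qed.

Lemma projection_star p : projection p -> star p = p.
Proof. by case. Qed.

Lemma projectionP p : star p = p -> p * p = p -> projection p.
Proof. by move=> ps pp; split; rewrite ?expr2 ?pp. Qed.

Lemma projection0 : projection (0 : A).
Proof. by apply: projectionP; rewrite ?star0 ?mulr0. Qed.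

Lemma projectionC p : projection p -> projection (1 - p).
Proof.
move=> pP; apply: projectionP; first by rewrite starB star1 (projection_star _ pP).
by rewrite mulrBl !mulrBr !mul1r mulr1 (projection_mulrr _ pP) subrr subr0.
Qed.

Lemma projection1 : projection (1 : A).
Proof. by rewrite -(subr0 1); apply: projectionC; exact: projection0. Qed.

Lemma projectionM p q : projection p -> projection q -> p * q = q * p ->
  projection (p * q).
Proof.
move=> pP qP pq; apply: projectionP.
  by rewrite starM (projection_star _ pP) (projection_star _ qP).
by rewrite {2}pq mulrA -(mulrA p) (projection_mulrr _ qP) -mulrA -pq mulrA
  (projection_mulrr _ pP).
Qed.

(** By the C*-identity [|p|] equals its own square. Norms thus tell zero from nonzero projections by
    the values 0 and 1, which is what makes the final formula two-valued. *)
Lemma cnorm_projection p : projection p -> p <> 0 -> cnorm p = 1.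
Proof.
move=> pP p0; have := cnorm_starM p.
rewrite (projection_star _ pP) (projection_mulrr _ pP) expr2.
have n0 : cnorm p != 0 by apply/eqP => /cnorm0_eq0.
by rewrite -{1}[cnorm p]mulr1 => /(mulfI n0).
Qed.

Lemma cball_projection p : projection p -> cball 1 p.
Proof.
move=> pP; rewrite /cball /=; have [->|/eqP p0] := eqVneq p 0.
  by rewrite cnorm0.
by rewrite cnorm_projection.
Qed.

End Norm.

(** * Splitting in the Boolean algebra of projections *)

Section BooleanAlgebra.
Context {R : realType} {A : cstarAlgType R}.
Hypothesis comm : forall p q : A, projection p -> projection q -> p * q = q * p.
Hypothesis nomin : forall p : A, projection p -> p <> 0 ->
  exists q : A, [/\ projection q, proj_lt 0 q & proj_lt q p].
Implicit Types (p q r x y : A) (s : seq A).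

(** Induction on [s], shrinking [r]. If the new [u] lies below [r], replace [r] by a projection [q]
    strictly between [0] and [u]: then [u] is not below [q], and neither is any earlier [v], since
    [q] is below [r]. *)
Lemma projection_avoid y s : projection y -> y <> 0 ->
  (forall u, u \in s -> projection u /\ u <> 0) ->
  exists r, [/\ projection r, r <> 0, r * y = r &
    forall u, u \in s -> u * r <> u].
Proof.
move=> yP y0; elim: s => [_|u s IH us].
  by exists y; split=> //; exact: projection_mulrr.
have [|r [rP r0 ry rs]] := IH.
  by move=> v vs; apply: us; rewrite inE vs orbT.
have [uP u0] := us u (mem_head _ _).
have [ur|/eqP ur] := eqVneq (u * r) u; last first.
  by exists r; split=> // v; rewrite inE => /predU1P[->//|]; exact: rs.
have [q [qP [_ q0] [qu neq_qu]]] := nomin u uP u0.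
have qr : q * r = q by rewrite -{1}qu -mulrA ur.
exists q; split=> //.
- exact: nesym.
- by rewrite -{1}qr -mulrA ry.
- move=> v; rewrite inE => /predU1P[->|vs vq].
    by rewrite (comm u q uP qP) qu.
  by apply: (rs v vs); rewrite -{1}vq -mulrA qr.
Qed.

(** Here [x] splits every element of [s] but lies above [y]. Moving a nonzero [r] below [y] from [x]
    to its complement repairs this, provided that [r] lies above neither [y] nor any [z * x]: then
    [y * (x - r)] and [z * (x - r)] are nonzero. *)
Lemma projection_split_cons x y s : projection x -> projection y -> y <> 0 ->
    y * x = y ->
    (forall z, z \in s -> [/\ projection z, z * x <> 0 & z * (1 - x) <> 0]) ->
  exists x', projection x' /\
    forall z, z \in y :: s -> z * x' <> 0 /\ z * (1 - x') <> 0.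
Proof.
move=> xP yP y0 yx sx.
have [|r [rP r0 ry rs]] := projection_avoid y (y :: [seq z * x | z <- s]) yP y0.
  move=> u; rewrite inE => /predU1P[->//|/mapP[z /sx[zP zx _] ->]].
  by split=> //; apply: projectionM => //; exact: comm.
have rx : r * x = r by rewrite -{1}ry -mulrA yx.
have xr : x * r = r by rewrite comm.
have yr : y * r = r by rewrite comm.
exists (x * (1 - r)); split.
  by apply: projectionM => //; [|apply: comm => //];
    exact: projectionC.
have xrE : x * (1 - r) = x - r by rewrite mulrBr mulr1 xr.
move=> z; rewrite inE => /predU1P[->|zs]; split.
- rewrite mulrA yx mulrBr mulr1 => /subr0_eq/esym.
  by apply: rs; rewrite mem_head.
- by rewrite xrE opprB addrA mulrBr mulrDr mulr1 yx yr [y + r]addrC addrK.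
- rewrite mulrA mulrBr mulr1 => /subr0_eq/esym.
  by apply: rs; rewrite inE (map_f (fun z => z * x) zs) orbT.
- have [zP _ zx] := sx z zs.
  (* Multiplication by [1 - x] turns [z * (1 - x')] into [z * (1 - x)], because [1 - x'] is
     [1 - x + r] with [r] below [x]. *)
  move/(congr1 ( *%R^~ (1 - x))); rewrite mul0r xrE opprB addrA -mulrA mulrBl.
  rewrite mulrDl mul1r.
  have -> : r * (1 - x) = 0 by rewrite mulrBr mulr1 rx subrr.
  have -> : x * (1 - x) = 0 by rewrite mulrBr mulr1 (projection_mulrr _ xP) subrr.
  by rewrite addr0 subr0.
Qed.

(** If the [x] found so far does not split [y], then [y] lies below [x] or below [1 - x]. Splitting
    is symmetric in these two, so [projection_split_cons] applies to one of them. *)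
Lemma projection_split s : (forall y, y \in s -> projection y /\ y <> 0) ->
  exists x, projection x /\
    forall y, y \in s -> y * x <> 0 /\ y * (1 - x) <> 0.
Proof.
elim: s => [_|y s IH ys].
  by exists 0; split; first exact: projection0.
have sP z : z \in s -> projection z /\ z <> 0.
  by move=> zs; apply: ys; rewrite inE zs orbT.
have [x [xP xs]] := IH sP.
have [yP y0] := ys y (mem_head _ _).
have sx z : z \in s -> [/\ projection z, z * x <> 0 & z * (1 - x) <> 0].
  by move=> zs; split; [case: (sP z zs)|case: (xs z zs)|case: (xs z zs)].
have [yx|/eqP yx] := eqVneq (y * (1 - x)) 0.
  apply: (projection_split_cons x) => //.
  by move: yx; rewrite mulrBr mulr1 => /subr0_eq.
have [yx0|/eqP yx0] := eqVneq (y * x) 0.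
  apply: (projection_split_cons (1 - x)) => //; first exact: projectionC.
    by rewrite mulrBr mulr1 yx0 subr0.
  by move=> z /sx[zP z1 z2]; rewrite subKr.
by exists x; split=> // z; rewrite inE => /predU1P[->//|/xs].
Qed.

(** Multiply [1] by each [x] in turn unless the product vanishes; shrinking [y] preserves the
    alternatives already obtained. *)
Lemma projection_unsplit s : (forall x, x \in s -> projection x) ->
  exists y, [/\ projection y, y <> 0 &
    forall x, x \in s -> y * x = 0 \/ y * (1 - x) = 0].
Proof.
elim: s => [_|x s IH xs].
  by exists 1; split; [exact: projection1|apply/eqP/oner_neq0|].
have [|y [yP y0 ys]] := IH.
  by move=> z zs; apply: xs; rewrite inE zs orbT.
have xP := xs x (mem_head _ _).
have [yx|/eqP yx] := eqVneq (y * x) 0.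
  by exists y; split=> // z; rewrite inE => /predU1P[->|/ys//]; left.
exists (y * x); split=> //; first by apply: projectionM => //; exact: comm.
move=> z; rewrite inE => /predU1P[->|zs].
  by right; rewrite -mulrA mulrBr mulr1 (projection_mulrr _ xP) subrr mulr0.
have zP : projection z by apply: xs; rewrite inE zs orbT.
rewrite (comm y x yP xP) -!mulrA.
by case: (ys z zs) => ->; rewrite mulr0; [left|right].
Qed.

End BooleanAlgebra.

(** * Two estimates on real numbers *)

(** The bound is only asked for [e <= 1], so that quadratic error terms can be absorbed into [c]. *)
Lemma le_mul_small_eq0 {R : realFieldType} (c x : R) : 0 < c -> 0 <= x ->
  (forall e, 0 < e -> e <= 1 -> x <= c * e) -> x = 0.
Proof.
move=> c0 x0 xc; apply/eqP; rewrite eq_le x0 andbT leNgt; apply/negP => x_gt0.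
pose e := Num.min 1 (x / (2 * c)).
have e0 : 0 < e by rewrite lt_min ltr01 divr_gt0 ?mulr_gt0.
have := xc e e0; rewrite ge_min lexx => /(_ isT).
apply/negP; rewrite -ltNge (@le_lt_trans _ _ (x / 2)) //; last by lra.
have -> : x / 2 = c * (x / (2 * c)) by field; rewrite gt_eqF.
by rewrite ler_pM2l // ge_min lexx orbT.
Qed.

Lemma exists_div_exp2_le {R : archiRealFieldType} (c e : R) : 0 <= c -> 0 < e ->
  exists n, c / 2 ^+ n <= e.
Proof.
move=> c0 e0; have ce : 0 <= c / e by rewrite divr_ge0 // ltW.
exists (Num.bound (c / e)).
have := @upper_nthrootP _ (c / e) _ (leqnn _).
by rewrite ltr_pdivrMr // ler_pdivrMr ?exprn_gt0 // mulrC => /ltW.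
Qed.

(** * Newton's method: projections near almost idempotent selfadjoint elements *)

Section Newton.
Context {R : realType} {A : cstarAlgType R}.
Implicit Types a p q : A.

Lemma cnorm1 : cnorm (1 : A) = 1.
Proof.
by apply: cnorm_projection; [exact: projection1|apply/eqP/oner_neq0].
Qed.

(** Serves twice: for limits of Newton iterates and for the closedness of the set of projections. *)
Lemma projection_approx p :
  (forall e, 0 < e -> exists q,
    [/\ star q = q, cnorm (p - q) <= e & cnorm (q * q - q) <= e]) ->
  projection p.
Proof.
move=> approx; have p0 := cnorm_ge0 p; apply: projectionP.
  apply/subr0_eq/cnorm0_eq0/(@le_mul_small_eq0 _ 2) => // [|e e0 e1].
    exact: cnorm_ge0.
  have [q [qs pq _]] := approx e e0.
  have := cnorm_distD q (star p) p.
  by rewrite -{1}qs -starB cnorm_star (cnorm_distC q); lra.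
(* The constant adds up the bounds on the four terms of the decomposition below: [|p|],
   [|q| <= |p| + 1], [1] and [1], each times [e]. *)
apply/subr0_eq/cnorm0_eq0/(@le_mul_small_eq0 _ (2 * cnorm p + 3)) => [||e e0 e1].
- lra.
- exact: cnorm_ge0.
have [q [_ pq qq]] := approx e e0.
have -> : p * p - p = (p - q) * p + q * (p - q) + (q * q - q) - (p - q).
  by rewrite mulrBl mulrBr; rewrite opprB !addrA !subrK.
have q1 : cnorm q <= cnorm p + e.
  by have := cnormB p (p - q); rewrite subKr; lra.
apply: le_trans (cnormB _ _) _.
apply: le_trans (lerD (cnormD _ _) (lexx _)) _.
apply: le_trans (lerD (lerD (cnormD _ _) (lexx _)) (lexx _)) _.
have := cnormM (p - q) p; have := cnormM q (p - q).
have := ler_wpM2r p0 pq.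
have := ler_pM (cnorm_ge0 q) (cnorm_ge0 (p - q)) q1 pq.
nra.
Qed.

Lemma cnorm_complete (u : nat -> A) (c : R) : 0 <= c ->
  (forall n k, cnorm (u (n + k)%N - u n) <= c / 2 ^+ n) ->
  exists p, forall n, cnorm (p - u n) <= c / 2 ^+ n.
Proof.
move=> c0 uc.
have /cauchy_cvgP/cvg_ex[p up] : cauchy (u @ \oo : set_system (cstar_normed A)).
  apply: cauchy_exP => e e0.
  (* Positive elements of [R[i]] are real. *)
  have [er er0 ->] : exists2 r : R, 0 < r & e = real_complex R r.
    move: e0; rewrite ltcE /= => /andP[/eqP im0 re0]; exists (complex.Re e) => //.
    by case: e im0 {re0} => r i /= ->.
  have [n ne] := @exists_div_exp2_le R c (er / 2) c0 (divr_gt0 er0 (ltr0Sn _ 1)).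
  exists (u n); exists n => // m /= nm; rewrite -ball_normE /=.
  rewrite (normr_cnorm (u n - u m : A)) ltcR cnorm_distC -(subnKC nm).
  by apply: le_lt_trans (uc _ _) _; apply: le_lt_trans ne _; lra.
exists p => n; apply/ler_addgt0Pr => e e0.
move/cvgrPdist_le : up => /(_ (real_complex R e)).
rewrite ltcR => /(_ e0)[m _ /(_ (m + n)%N (leq_addr _ _))].
rewrite (normr_cnorm (p - u _ : A)) lecR => pu.
have := uc n m; rewrite addnC => unm.
by apply: le_trans (cnorm_distD (u (m + n)%N) _ _) _; rewrite addrC lerD.
Qed.

Definition defect a := a * a - a.

(* One step of Newton's method for [a ^+ 2 - a = 0], with [(a *+ 2 - 1)^-1]
   replaced by its approximation [a *+ 2 - 1]: the square of [a *+ 2 - 1] is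
   [defect a *+ 4 + 1]. *)
Definition newton a := a - defect a * (a *+ 2 - 1).

(** Both sides are values at [a] of polynomials in one variable, so the identity is checked in a
    commutative polynomial ring and transported by [horner_alg a]. *)
Lemma defect_newton a :
  defect (newton a) = defect a * defect a * (defect a *+ 4 - 1 *+ 3).
Proof.
rewrite /newton /defect -[a](horner_algX a) -(rmorph1 (horner_alg a)).
rewrite -!(rmorphM, rmorphB, rmorphMn) /=; congr (horner_alg a _).
ring.
Qed.

Lemma star_newton a : star a = a -> star (newton a) = newton a.
Proof.
move=> sa; rewrite /newton /defect starB starM !starB mulr2n starD starM star1 sa.
congr (_ - _).
rewrite -[a](horner_algX a) -(rmorph1 (horner_alg a)).
rewrite -!(rmorphM, rmorphB, rmorphD) /=; congr (horner_alg a _).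
ring.
Qed.

(** For selfadjoint [a], [|a|^2 = |a * a| <= |defect a| + |a|]. *)
Lemma cnorm_le2 a : star a = a -> cnorm (defect a) <= 8^-1 -> cnorm a <= 2.
Proof.
move=> sa da; have := cnorm_starM a; rewrite sa.
have := cnormD (defect a) a; rewrite /defect subrK => /[swap] ->.
have := cnorm_ge0 a; rewrite -/(defect a); nra.
Qed.

(** With [d <= 1/8] the norm of the old defect, [defect_newton] bounds the new one by
    [d * d * (4 * d + 3)], and [d * (4 * d + 3) <= 7/16]. The constant [5] bounds the norm of
    [a *+ 2 - 1], by [cnorm_le2]. *)
Lemma newton_step a : star a = a -> cnorm (defect a) <= 8^-1 ->
  cnorm (defect (newton a)) <= cnorm (defect a) / 2 /\
  cnorm (newton a - a) <= 5 * cnorm (defect a).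
Proof.
move=> sa da; have a2 := cnorm_le2 a sa da; have d0 := cnorm_ge0 (defect a).
split.
  rewrite defect_newton.
  apply: le_trans (cnormM _ _) _.
  have h1 := cnormM (defect a) (defect a).
  have := cnormB (defect a *+ 4) (1 *+ 3).
  rewrite !cnormMn cnorm1 => h2.
  have := ler_pM (cnorm_ge0 _) (cnorm_ge0 _) h1 h2.
  nra.
rewrite /newton addrAC subrr add0r cnormN.
apply: le_trans (cnormM _ _) _; rewrite mulrC ler_wpM2r //.
by apply: le_trans (cnormB _ _) _; rewrite cnormMn cnorm1; lra.
Qed.

Lemma iter_newton a n : star a = a -> cnorm (defect a) <= 8^-1 ->
  star (iter n newton a) = iter n newton a /\
  cnorm (defect (iter n newton a)) <= cnorm (defect a) / 2 ^+ n.
Proof.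
move=> sa da; have d0 := cnorm_ge0 (defect a).
elim: n => [|n [sn dn]]; first by rewrite expr0 divr1.
split; first by rewrite iterS; exact: star_newton.
have dn8 : cnorm (defect (iter n newton a)) <= 8^-1.
  apply: le_trans dn _; apply: le_trans da.
  by rewrite ler_piMr // invf_le1 ?exprn_gt0 // exprn_ege1 // ler1n.
have [dS _] := newton_step _ sn dn8.
rewrite iterS exprSr invfM mulrA; apply: le_trans dS _.
by rewrite ler_wpM2r // invr_ge0.
Qed.

Lemma exists_projection_near a : star a = a -> cnorm a <= 1 ->
  exists2 p, projection p & cnorm (a - p) <= 10 * cnorm (defect a).
Proof.
move=> sa a1; have d0 := cnorm_ge0 (defect a).
have [da|da] := lerP (cnorm (defect a)) 8^-1; last first.
  (* A defect above [1/8] makes the bound exceed [1 >= |a|], so [0] is near enough. *)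
  by exists 0; [exact: projection0|rewrite subr0; lra].
pose u n := iter n newton a; pose c := 10 * cnorm (defect a).
(* The step at index [n + k] has length at most [5 * |defect a| / 2 ^+ (n + k)], which is
   [c / 2 ^+ (n + k) - c / 2 ^+ (n + k).+1], so the bounds telescope; hence the factor [10] in
   [c]. *)
have uc n k : cnorm (u (n + k)%N - u n) <= c / 2 ^+ n - c / 2 ^+ (n + k)%N.
  elim: k => [|k IH]; first by rewrite addn0 !subrr cnorm0.
  have [sn dn] := iter_newton a (n + k) sa da.
  have [|_] := newton_step _ sn.
    apply: le_trans dn _; apply: le_trans da.
    by rewrite ler_piMr // invf_le1 ?exprn_gt0 // exprn_ege1 // ler1n.
  rewrite -iterS -addnS -/(u _) -/(u (n + k)%N) in dn * => uS.
  apply: le_trans (cnorm_distD (u (n + k)%N) _ _) _.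
  have -> : 2 ^+ (n + k.+1) = 2 ^+ (n + k) * 2 :> R by rewrite addnS exprSr.
  by move: IH dn; rewrite invfM /c; lra.
have c0 : 0 <= c by rewrite mulr_ge0.
have [|p pu] := cnorm_complete u c c0.
  by move=> n k; apply: le_trans (uc _ _) _; rewrite gerBl divr_ge0 // exprn_ge0.
exists p; last first.
  by have := pu 0%N; rewrite expr0 divr1 cnorm_distC.
apply: projection_approx => e e0; have [n ne] := exists_div_exp2_le c e c0 e0.
have [sn dn] := iter_newton a n sa da.
exists (u n); split=> //; first exact: le_trans (pu n) ne.
apply: le_trans dn _; apply: le_trans ne; rewrite ler_wpM2r ?invr_ge0 ?exprn_ge0 //.
by rewrite /c; lra.
Qed.

End Newton.

(** * Infima and maxima of real numbers *)

Section Inf.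
Context {R : realType}.
Implicit Types S : set R.

Lemma inf_ge0_le S x : (forall z, S z -> 0 <= z) -> S x -> inf S <= x.
Proof. by move=> S0 Sx; apply: ge_inf => //; exists 0. Qed.

Lemma inf_ge0_le_inf S S' : (forall z, S z -> 0 <= z) -> S' !=set0 ->
  (forall y, S' y -> exists2 z, S z & z <= y) -> inf S <= inf S'.
Proof.
move=> S0 S'0 SS'; apply: lb_le_inf => // y /SS'[z Sz].
by apply: le_trans; exact: inf_ge0_le.
Qed.

Lemma bigmax_coord_continuous m (s : seq 'I_m) :
  continuous (fun v : 'rV[R]_m => \big[Num.max/0]_(i <- s) v 0 i).
Proof.
elim: s => [|i s IH].
  by under eq_fun do rewrite big_nil; exact: cst_continuous.
under eq_fun do rewrite big_cons.
move=> v; apply: (@continuous_max _ _ (fun v : 'rV[R]_m => v 0 i)).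
  exact: coord_continuous.
exact: IH.
Qed.

End Inf.

(** * Distance to the set of projections *)

Section DistProjection.
Context {R : realType} {M : cstarAlgType R}.
Implicit Types (a p : M).

Definition dist_projection a : R :=
  inf [set cnorm (a - p) | p in [set p : M | projection p]].

Lemma dist_projection_le a p : projection p -> dist_projection a <= cnorm (a - p).
Proof.
by move=> pP; apply: inf_ge0_le; [move=> _ [q _ <-]; exact: cnorm_ge0|exists p].
Qed.

(** The right-hand side quantifies over a ball, as a formula must. One inequality takes a projection
    near [star y * y]; the other takes [y := p], where the penalty vanishes. *)
Lemma dist_projectionE a : dist_projection a =
  inf [set cnorm (a - star y * y) + 10 * cnorm (defect (star y * y)) |
    y in cball 1].
Proof.
apply/le_anti/andP; split; apply: inf_ge0_le_inf.
- by move=> _ [p _ <-]; exact: cnorm_ge0.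
- by exists (cnorm (a - star 0 * 0) + 10 * cnorm (defect (star (0 : M) * 0)));
    exists 0 => //; apply: cball_projection; exact: projection0.
- move=> _ [y y1 <-].
  have [||p pP yp] := exists_projection_near (star y * y).
  + by rewrite starM starK.
  + by rewrite cnorm_starM expr_le1 // cnorm_ge0.
  exists (cnorm (a - p)); first by exists p.
  by apply: le_trans (cnorm_distD (star y * y) _ _) _; rewrite lerD2l.
- move=> _ [y _ <-]; have := cnorm_ge0 (a - star y * y).
  by have := cnorm_ge0 (defect (star y * y)); lra.
- by exists (cnorm (a - 0)); exists 0 => //; exact: projection0.
- move=> _ [p pP <-]; exists (cnorm (a - p)) => //; exists p.
    exact: cball_projection.
  rewrite /defect (projection_star _ pP) !(projection_mulrr _ pP).
  by rewrite subrr cnorm0 mulr0 addr0.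
Qed.

Definition projection_tuples m : set 'rV[M]_m :=
  [set x | forall i, projection (x 0 i)].

(** In the maximum metric, projections within [e] of optimal in each coordinate form a tuple within
    [e] of optimal. *)
Lemma set_dist_projection_tuples m (x : 'rV[M]_m) :
  set_dist x (projection_tuples m) = \big[Num.max/0]_(i < m) dist_projection (x 0 i).
Proof.
have tdist_ge0 (y : 'rV[M]_m) : 0 <= tdist x y.
  exact: bigmax_ge_id.
apply/le_anti/andP; split.
  apply/ler_addgt0Pr => e e0.
  have near i : exists p, projection p /\
      cnorm (x 0 i - p) < dist_projection (x 0 i) + e.
    have [||_ [p pP <-] xp] := @inf_lt _ [set cnorm (x 0 i - p) |
        p in [set p : M | projection p]] (dist_projection (x 0 i) + e).
    - by exists (cnorm (x 0 i - 0)); exists 0 => //; exact: projection0.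
    - by rewrite ltrDl.
    by exists p.
  have [p pP] := choice near.
  have : set_dist x (projection_tuples m) <= tdist x (\row_i p i).
    apply: inf_ge0_le; first by move=> _ [y _ <-].
    by exists (\row_i p i) => // i; rewrite mxE; case: (pP i).
  move/le_trans; apply; apply: bigmax_le => [|i _].
    by rewrite addr_ge0 ?(ltW e0) // bigmax_ge_id.
  rewrite mxE; apply: le_trans (ltW (pP i).2) _; rewrite lerD2r.
  exact: (@le_bigmax _ _ _ _ (fun i => dist_projection (x 0 i))).
apply: lb_le_inf.
  exists (tdist x 0); exists 0 => // i; rewrite mxE; exact: projection0.
move=> _ [y yP <-]; apply: le_bigmax2 => i _; exact: dist_projection_le.
Qed.

Lemma closed_projection_tuples m : closed (projection_tuples m).
Proof.
move=> x clx i; apply: projection_approx => e e0.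
have e0c : 0 < real_complex R e by rewrite ltcR.
have [y [yP [_ xy]]] := clx _ (nbhsx_ballx x _ e0c).
have := xy 0 i; rewrite -ball_normE /= (normr_cnorm (x 0 i - y 0 i : M)) ltcR => xyi.
exists (y 0 i); split; first exact: projection_star.
- exact: ltW.
- by rewrite (projection_mulrr _ (yP i)) subrr cnorm0 ltW.
Qed.

End DistProjection.

(** * Syntactic formulas and their values *)

Section Formulas.
Context {R : realType}.

Lemma definable_formula_feval n (rho : 'rV[R]_n) (T : theory R) (f : formula R n) :
  definable_formula T rho (fun M => @feval R M n f).
Proof.
exists (fun=> f) => e e0; exists 0%N => k _ M _ x _.
by rewrite subrr normr0 ltW.
Qed.

Lemma vcons0 (M : cstarAlgType R) n (a : M) (x : 'rV[M]_n) : vcons a x 0 ord0 = a.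
Proof.
transitivity (row_mx (const_mx a : 'rV[M]_1) x 0 (lshift n 0)).
  by apply: (congr1 (row_mx (const_mx a) x 0)); exact: val_inj.
by rewrite row_mxEl mxE.
Qed.

Lemma vconsS (M : cstarAlgType R) n (a : M) (x : 'rV[M]_n) i :
  vcons a x 0 (lift ord0 i) = x 0 i.
Proof.
rewrite -(row_mxEr (const_mx a : 'rV[M]_1) x).
by apply: (congr1 (row_mx (const_mx a) x 0)); exact: val_inj.
Qed.

Lemma penalty_continuous :
  continuous (fun v : 'rV[R]_2 => v 0 0 + 10 * v 0 1).
Proof.
move=> v; apply: (@continuousD _ R^o _ (fun v : 'rV[R]_2 => v 0 0)).
  exact: coord_continuous.
apply: (@continuousM _ _ (fun=> 10) (fun v : 'rV[R]_2 => v 0 1)).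
  exact: cst_continuous.
exact: coord_continuous.
Qed.

(** The right-hand side of [dist_projectionE] in syntax: [y] is the bound variable [0], past which
    [lift ord0] shifts the free variable [i]. *)
Definition dist_projection_formula n (i : 'I_n) : formula R n :=
  let y := TVar R (ord0 : 'I_n.+1) in
  let z := TMul (TStar y) y in
  FInf 1%:pos (FConn penalty_continuous (fun j => FNorm (if j == 0
    then TAdd (TVar R (lift ord0 i)) (TScale (-1) z)
    else TAdd (TMul z z) (TScale (-1) z)))).

Lemma feval_dist_projection (M : cstarAlgType R) n (i : 'I_n) (x : 'rV[M]_n) :
  feval (dist_projection_formula n i) x = dist_projection (x 0 i).
Proof.
rewrite dist_projectionE /=; congr inf; apply: eq_imagel => y _.
by rewrite !mxE /= vcons0 vconsS !scaleN1r.
Qed.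

Definition dist_projection_tuples_formula m : formula R m :=
  FConn (bigmax_coord_continuous m (index_enum 'I_m))
    (@dist_projection_formula m).

Lemma feval_dist_projection_tuples (M : cstarAlgType R) m (x : 'rV[M]_m) :
  feval (dist_projection_tuples_formula m) x = set_dist x (projection_tuples m).
Proof.
rewrite set_dist_projection_tuples; apply: eq_bigr => i _.
by rewrite mxE -feval_dist_projection.
Qed.

Lemma definable_projection_tuples (T : theory R) m :
  definable_set T (const_mx 1 : 'rV_m) (fun M => @projection_tuples R M m).
Proof.
split=> [i|M _|].
- by rewrite mxE.
- split; last 1 first.
  + by exists 0 => i; rewrite mxE; exact: projection0.
  + by move=> x xP i; rewrite mxE; exact: cball_projection.
  + exact: closed_projection_tuples.
have -> : (fun (M : cstarAlgType R) x => set_dist x (projection_tuples m)) =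
    (fun M => @feval R M m (dist_projection_tuples_formula m)).
  by apply: functional_extensionality_dep => M; apply/funext => x;
    rewrite feval_dist_projection_tuples.
exact: definable_formula_feval.
Qed.

(* On projections, the indicator function of "[y] is unsplit by [x]". *)
Definition unsplit {M : cstarAlgType R} (x y : M) : R :=
  cnorm y * (1 - cnorm (y * x) * cnorm (y * (1 - x))).

Lemma unsplit_continuous :
  continuous (fun v : 'rV[R]_3 => v 0 0 * (1 - v 0 1 * v 0 2%R)).
Proof.
move=> v; apply: (@continuousM _ _ (fun v : 'rV[R]_3 => v 0 0)).
  exact: coord_continuous.
apply: (@continuousB _ R^o _ (fun=> 1) (fun v : 'rV[R]_3 => v 0 1 * v 0 2%R)).
  exact: cst_continuous.
by apply: (@continuousM _ _ (fun v : 'rV[R]_3 => v 0 1)); exact: coord_continuous.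
Qed.

Definition unsplit_formula n (i j : 'I_n) : formula R n :=
  let x := TVar R i in let y := TVar R j in
  FConn unsplit_continuous (fun k => FNorm (nth y
    [:: y; TMul y x; TMul y (TAdd (TOne R n) (TScale (-1) x))] k)).

Lemma feval_unsplit (M : cstarAlgType R) n (i j : 'I_n) (x : 'rV[M]_n) :
  feval (unsplit_formula n i j) x = unsplit (x 0 i) (x 0 j).
Proof. by rewrite /= !mxE /= scaleN1r. Qed.

Lemma dominates_continuous :
  continuous (fun v : 'rV[R]_2 => 1 - v 0 0 * (1 - v 0 1)).
Proof.
move=> v; apply: (@continuousB _ R^o _ (fun=> 1)
    (fun v : 'rV[R]_2 => v 0 0 * (1 - v 0 1))).
  exact: cst_continuous.
apply: (@continuousM _ _ (fun v : 'rV[R]_2 => v 0 0)).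
  exact: coord_continuous.
apply: (@continuousB _ R^o _ (fun=> 1) (fun v : 'rV[R]_2 => v 0 1)).
  exact: cst_continuous.
exact: coord_continuous.
Qed.

(** As [0] means true, this says of [(x, y)] and [(x', y')] that [y'] is unsplit by [x] while [y] is
    not unsplit by [x']. *)
Definition dominates_formula : formula R (2 + 2) :=
  FConn dominates_continuous (fun k => if k == 0
    then unsplit_formula _ (lshift 2 0) (rshift 2 1)
    else unsplit_formula _ (rshift 2 0) (lshift 2 1)).

Lemma feval_dominates (M : cstarAlgType R) (a b : 'rV[M]_2) :
  feval dominates_formula (row_mx a b) =
  1 - unsplit (a 0 0) (b 0 1) * (1 - unsplit (b 0 0) (a 0 1)).
Proof.
rewrite -(row_mxEl a b 0 0) -(row_mxEl a b 0 1) -(row_mxEr a b 0 0).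
rewrite -(row_mxEr a b 0 1) -!feval_unsplit.
by congr (1 - _ * (1 - _)); rewrite mxE.
Qed.

End Formulas.

(** * Values of [unsplit] on projections *)

Section Unsplit.
Context {R : realType} {M : cstarAlgType R}.
Hypothesis comm : forall p q : M, projection p -> projection q -> p * q = q * p.
Implicit Types x y : M.

(** Commutativity makes [y * x] and [y * (1 - x)] projections, so for [y <> 0] all three norms are
    [1]. *)
Lemma unsplit_eq0 x y : projection x -> projection y ->
  (y <> 0 -> y * x <> 0 /\ y * (1 - x) <> 0) -> unsplit x y = 0.
Proof.
move=> xP yP yx; rewrite /unsplit.
have [->|/eqP y0] := eqVneq y 0; first by rewrite cnorm0 mul0r.
have [yx0 yx1] := yx y0.
have xP' := projectionC _ xP.
by rewrite !cnorm_projection ?mulr1 ?subrr ?mulr0 //; apply: projectionM => //;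
  exact: comm.
Qed.

Lemma unsplit_eq1 x y : projection y -> y <> 0 ->
  y * x = 0 \/ y * (1 - x) = 0 -> unsplit x y = 1.
Proof.
move=> yP y0; rewrite /unsplit => -[] ->;
  by rewrite cnorm0 ?mul0r ?mulr0 subr0 mulr1 cnorm_projection.
Qed.

Lemma unsplit_01 x y : projection x -> projection y ->
  unsplit x y = 0 \/ unsplit x y = 1.
Proof.
move=> xP yP.
have [y0|/eqP y0] := eqVneq y 0; first by left; apply: unsplit_eq0.
have [yx|/eqP yx] := eqVneq (y * x) 0; first by right; apply: unsplit_eq1; auto.
have [yx'|/eqP yx'] := eqVneq (y * (1 - x)) 0.
  by right; apply: unsplit_eq1; auto.
by left; apply: unsplit_eq0.
Qed.

End Unsplit.

Theorem lemma4p1 (R : realType) (T : theory R)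
    (Tcomplete : complete_theory T)
    (Tcomm : forall A : cstarAlgType R, satisfies A T ->
       forall p q : A, projection p -> projection q -> p * q = q * p)
    (Tnomin : forall A : cstarAlgType R, satisfies A T ->
       forall p : A, projection p -> p <> 0 ->
         exists q : A, [/\ projection q, proj_lt 0 q & proj_lt q p]) :
  exists (m : nat) (rho : 'rV[R]_m)
         (X : forall M : cstarAlgType R, set 'rV[M]_m)
         (phi : forall M : cstarAlgType R, 'rV[M]_(m + m) -> R),
    [/\ definable_set T rho X,
        definable_formula T (row_mx rho rho) phi,
        forall M : cstarAlgType R, satisfies M T ->
          forall a b, X M a -> X M b ->
            phi M (row_mx a b) = 0 \/ phi M (row_mx a b) = 1,
        forall M : cstarAlgType R, satisfies M T ->
          forall a b, X M a -> X M b ->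
            phi M (row_mx a b) = 0 -> phi M (row_mx b a) = 1 &
        forall M : cstarAlgType R, satisfies M T ->
          forall (n : nat) (a : 'I_n -> 'rV[M]_m), (forall i, X M (a i)) ->
            exists2 b, X M b & forall i, phi M (row_mx (a i) b) = 0].
Proof.
(* In a pair of projections, coordinate [0] does the splitting and coordinate [1] is the one to be
   split. *)
exists 2%N, (const_mx 1), (fun M => @projection_tuples R M 2),
  (fun M => @feval R M _ (dominates_formula)).
split; [exact: definable_projection_tuples|exact: definable_formula_feval| | |].
- move=> M MT a b aP bP; rewrite feval_dominates.
  have [->|->] := unsplit_01 (Tcomm M MT) (a 0 0) (b 0 1) (aP 0) (bP 1).
    by right; rewrite mul0r subr0.
  have [->|->] := unsplit_01 (Tcomm M MT) (b 0 0) (a 0 1) (bP 0) (aP 1).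
    by left; rewrite subr0 mulr1 subrr.
  by right; rewrite subrr mulr0 subr0.
(* Value [0] at [(a, b)] forces [unsplit (a 0 0) (b 0 1) = 1], which kills the product in the value
   at [(b, a)]. *)
- move=> M MT a b aP bP; rewrite !feval_dominates.
  have [->|->] := unsplit_01 (Tcomm M MT) (a 0 0) (b 0 1) (aP 0) (bP 1).
    by rewrite mul0r subr0 => /eqP; rewrite oner_eq0.
  by rewrite subrr mulr0 subr0.
- move=> M MT n a aP.
  have [|y [yP y0 yx]] := projection_unsplit (Tcomm M MT)
      [seq a i 0 0 | i <- enum 'I_n].
    by move=> _ /mapP[i _ ->]; exact: aP.
  (* Zero cannot be split and is filtered out; [unsplit] vanishes at a zero second argument
     anyway. *)
  have [|x [xP xy]] := projection_split (Tcomm M MT) (Tnomin M MT)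
      [seq z <- [seq a i 0 1 | i <- enum 'I_n] | z != 0].
    move=> z; rewrite mem_filter => /andP[/eqP z0 /mapP[i _ zE]]; split=> //.
    by rewrite zE; exact: aP.
  exists (\row_(k < 2) if k == 0 then x else y).
    by move=> k; rewrite mxE; case: ifP.
  move=> i; rewrite feval_dominates !mxE /=.
  rewrite unsplit_eq1 //; last first.
    by apply: yx; apply: map_f; rewrite mem_enum.
  rewrite (unsplit_eq0 (Tcomm M MT)) ?subr0 ?mulr1 ?subrr //; first exact: aP.
  move=> /eqP ai0; apply: xy; rewrite mem_filter ai0.
  by apply: map_f; rewrite mem_enum.
Qed.
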